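(* Let $u\le w$ in $S_n$ with $w$ $k$-Grassmannian. Then $\mathcal{L}_k'(u,w)=\mathcal{L}_k(u,w)$.
   Context: Fix $1\le k<n$. $\le$ is Bruhat order on $S_n$, $\lessdot$ its covers. A permutation $w$ is $k$-Grassmannian if $w(1)<\dots<w(k)$ and $w(k+1)<\dots<w(n)$. Write $u\lessdot_k v$ if $u\lessdot v$ and $\{u(1),\dots,u(k)\}\neq\{v(1),\dots,v(k)\}$; $\le_k$ is the reflexive transitive closure of $\lessdot_k$, and $<_k$ its strict part. $(u,w]=\{x\in S_n: u<x\le w\}$. Permutations are composed as functions, so $u\cdot(a\ b)$ swaps the values of $u$ at positions $a$ and $b$. $\mathcal{L}_k'(u,w)$ is the set of all $x\in(u,w]$ such that every $\bar u$ with $u\lessdot\bar u\le x$ satisfies $u<_k\bar u$. $\mathcal{L}_k(u,w)$ is the set of all $x\in(u,w]$ for which there exist transpositions $t_i=(a_i\ b_i)$, $1\le i\le m$, with $a_i\le k<b_i$, and a chain $u\lessdot_k ut_1\lessdot_k ut_1t_2\lessdot_k\cdots\lessdot_k ut_1t_2\cdots t_m=x$, such that for each $1\le i<m$ either $b_i>b_{i+1}$, or $b_i=b_{i+1}$ and $a_i<a_{i+1}$. *)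

(* Defs.v *)
From mathcomp Require Import all_boot all_fingroup.

Set Implicit Arguments.
Unset Strict Implicit.
Unset Printing Implicit Defensive.

(* Positions and values are numbered from 0: position i of the usual
   convention is the ordinal i - 1, so "i <= k" reads "i < k" on ordinals and
   "k < i" reads "k <= i". *)

Section Bruhat.
Variable n : nat.
Implicit Types (u v w x : 'S_n) (t : 'I_n * 'I_n).

(* The product of {perm T} is left-to-right, (s * t) i = t (s i), so
   u \o (a b) is tperm a b * u: it swaps the values at positions a and b. *)
Definition swap_pos u t : 'S_n := (tperm t.1 t.2 * u)%g.

Definition inversions u : {set 'I_n * 'I_n} :=
  [set p : 'I_n * 'I_n | (p.1 < p.2) && (u p.2 < u p.1)].

Definition perm_length u : nat := #|inversions u|.

Definition bruhat_step : rel 'S_n := fun u v =>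
  [exists t, (v == swap_pos u t) && (perm_length u < perm_length v)].

Definition bruhat_le : rel 'S_n := connect bruhat_step.

Definition bruhat_lt : rel 'S_n := fun u v => (u != v) && bruhat_le u v.

Definition bruhat_cover : rel 'S_n := fun u v =>
  bruhat_lt u v && ~~ [exists x, bruhat_lt u x && bruhat_lt x v].

Variable k : nat.

Definition first_values u : {set 'I_n} := u @: [set i : 'I_n | i < k].

Definition kcover : rel 'S_n := fun u v =>
  bruhat_cover u v && (first_values u != first_values v).

Definition kbruhat_le : rel 'S_n := connect kcover.

Definition kbruhat_lt : rel 'S_n := fun u v => (u != v) && kbruhat_le u v.

Definition grassmannian w : Prop :=
  (forall i j : 'I_n, i < j -> j < k -> w i < w j) /\
  (forall i j : 'I_n, k <= i -> i < j -> w i < w j).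

(* x \in (u, w] *)
Definition in_interval u w x : bool := bruhat_lt u x && bruhat_le x w.

Definition Lk' u w x : Prop :=
  in_interval u w x /\
  (forall v, bruhat_cover u v -> bruhat_le v x -> kbruhat_lt u v).

Definition label_order : rel ('I_n * 'I_n) := fun t t' =>
  (t'.2 < t.2) || ((t.2 == t'.2) && (t.1 < t'.1)).

(* For ts = [:: t_1; ...; t_m] this is [:: u t_1; u t_1 t_2; ...; u t_1 ... t_m],
   without the starting point u. *)
Definition chain_of u (ts : seq ('I_n * 'I_n)) : seq 'S_n :=
  scanl swap_pos u ts.

Definition Lk u w x : Prop :=
  in_interval u w x /\
  (exists ts : seq ('I_n * 'I_n),
     [/\ all (fun t : 'I_n * 'I_n => t.1 < k <= t.2) ts,
         path kcover u (chain_of u ts),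
         last u (chain_of u ts) = x
       & sorted label_order ts]).

End Bruhat.

(* Main.v *)
Require Import Defs.
From mathcomp Require Import all_boot all_fingroup.
From mathcomp Require Import zify.

Set Implicit Arguments.
Unset Strict Implicit.
Unset Printing Implicit Defensive.

(** Call a label [(a, b)] crossing when [a < k <= b], and call the labels of the
    covers of [u] that lie below [x] the atoms of [[u, x]].  A cover of [u] is a
    [k]-cover exactly when its label is crossing, so [Lk'] asks that all atoms of
    [[u, x]] be crossing, and [Lk] asks for a chain from [u] to [x] with crossing
    labels that increase for [label_order].  Declare the labels that do not cross
    to be smaller than those that do.  The resulting order on labels comes from a
    reflection order, for which the Bruhat order is lexicographically shellable:
    each interval has exactly one increasing maximal chain, and this chain starts
    with the smallest atom.  If all atoms cross, then the increasing chain starts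
    with a crossing label, hence has only crossing labels; conversely, if the
    increasing chain is crossing, then its first label, the smallest atom, is
    crossing, hence all atoms are.

    Only two fragments of shellability are needed.

    To build the chain, start with the smallest atom [t].  A step [s] that follows
    [t] without being larger can be exchanged: the interval of length two from [u]
    to [u t s] has a second atom, and this one comes before [t]
    ([atom_exchange]).  Hence all atoms of the remaining interval cross and lie
    above [t], and induction on the length applies ([increasing_chain]).

    To see that no atom [(a, b)] of an interval with an increasing crossing chain
    fails to cross, use the number of points of the graph of a permutation in an
    upper right quadrant, which is monotone for the Bruhat order.  For a suitable
    quadrant with corner in the rectangle spanned by the points of [u] over [a] and
    [b], the swap of [a] and [b] lowers this number, but no step of the chain
    changes it ([corner_rank_right_atom] for [k <= a], [corner_rank_left_atom] for
    [b < k]). *)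

Section Bruhat.
Variable n : nat.
Implicit Types (u v w x : 'S_n) (a b c d e i : 'I_n) (t s : 'I_n * 'I_n).

(** * Swapping positions *)

Lemma swap_posE u t i : swap_pos u t i = u (tperm t.1 t.2 i).
Proof. by rewrite permM. Qed.

Lemma perm_val_neq u i e : i != e -> (u i : nat) <> u e.
Proof. by move=> ne /val_inj/perm_inj/eqP; rewrite (negPf ne). Qed.

Lemma swap_posK u t : swap_pos (swap_pos u t) t = u.
Proof. by rewrite /swap_pos mulgA tperm2 mul1g. Qed.

Lemma swap_pos_conjl u a b c d :
  swap_pos (swap_pos u (a, b)) (c, d) =
  swap_pos (swap_pos u (c, d)) (tperm c d a, tperm c d b).
Proof.
rewrite /swap_pos /= -tpermJ /conjg tpermV !mulgA.
by rewrite -(mulgA (_ * _)%g _ (tperm c d)) tperm2 mulg1.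
Qed.

Lemma swap_pos_conjr u a b c d :
  swap_pos (swap_pos u (a, b)) (c, d) =
  swap_pos (swap_pos u (tperm a b c, tperm a b d)) (a, b).
Proof. by rewrite /swap_pos /= -tpermJ /conjg tpermV !mulgA tperm2 mul1g. Qed.

(** Transporting an inversion by the transposition, unless this reverses the order
    of its two positions, embeds the inversions of [u] in those of the swapped
    permutation, and misses [(a, b)]. *)
Lemma perm_length_swap u a b :
  a < b -> u a < u b -> perm_length u < perm_length (swap_pos u (a, b)).
Proof.
move=> ab uab; pose tau := tperm a b.
pose phi (p : 'I_n * 'I_n) := if tau p.1 < tau p.2 then (tau p.1, tau p.2) else p.
have phi_inj : {in inversions u &, injective phi}.
  move=> [p q] [p' q']; rewrite !inE /= => /andP[pq _] /andP[pq' _].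
  rewrite /phi /=; case: ifP => h; case: ifP => h' //.
  - by case=> /perm_inj -> /perm_inj ->.
  - by case=> ep eq; move: h'; rewrite -ep -eq !tpermK pq.
  - by case=> ep eq; move: h; rewrite ep eq !tpermK pq'.
rewrite /perm_length -(card_in_imset phi_inj); apply: proper_card.
apply/properP; split; last first.
  exists (a, b).
    by rewrite inE /= !swap_posE /= tpermL tpermR ab.
  apply/imsetP => -[[p q]]; rewrite inE /= /phi /= => /andP[pq upq].
  case: ifP => _ [ea eb].
    have ep : p = b by rewrite -(tpermK a b p) -/tau -ea tpermL.
    have eq : q = a by rewrite -(tpermK a b q) -/tau -eb tpermR.
    by move: pq; rewrite ep eq; lia.
  by move: upq; rewrite -ea -eb; lia.
apply/subsetP => r /imsetP[[p q]]; rewrite inE /= => /andP[pq upq] ->.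
rewrite /phi /=; case: ifP => /= h; rewrite inE /= !swap_posE /=.
  by rewrite /tau !tpermK upq h.
rewrite pq /=; move: h pq upq; rewrite /tau.
case: tpermP => [->|->|/eqP pa /eqP pb]; case: tpermP => [->|->|/eqP qa /eqP qb]; lia.
Qed.

(** * Covers of the Bruhat order *)

(** The rectangle spanned by the points of the graph of [u] at the two positions
    contains no further point of the graph; [bruhat_cover_swap] identifies this
    with the covers of [u]. *)
Definition covers_at u t : bool :=
  [&& t.1 < t.2, u t.1 < u t.2
    & [forall e : 'I_n, (t.1 < e < t.2) ==> (u e < u t.1) || (u t.2 < u e)]].

Lemma covers_atP u a b :
  reflect [/\ a < b, u a < u b
            & forall e, a < e -> e < b -> (u e < u a) || (u b < u e)]
          (covers_at u (a, b)).
Proof.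
apply: (iffP and3P) => -[ab uab h]; split=> //.
  by move=> e ae eb; move/forallP: h => /(_ e) /=; rewrite ae eb.
by apply/forallP => e /=; apply/implyP => /andP[ae eb]; apply: h.
Qed.

Lemma bruhat_step_swap u a b :
  a < b -> u a < u b -> bruhat_step u (swap_pos u (a, b)).
Proof.
by move=> ab uab; apply/existsP; exists (a, b); rewrite eqxx perm_length_swap.
Qed.

Lemma bruhat_le_swap u a b :
  a < b -> u a < u b -> bruhat_le u (swap_pos u (a, b)).
Proof. by move=> ab uab; apply: connect1; apply: bruhat_step_swap. Qed.

Lemma swap_pos_ascent u a b :
  a < b -> perm_length u < perm_length (swap_pos u (a, b)) -> u a < u b.
Proof.
move=> ab len; have := @perm_val_neq u a b; case: ltngtP => // uba.
  have := @perm_length_swap (swap_pos u (a, b)) a b ab.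
  by rewrite swap_posK !swap_posE /= tpermL tpermR; lia.
by move=> /(_ _ uba)[]; apply/eqP => e; move: ab; rewrite e ltnn.
Qed.

Lemma bruhat_stepP u v :
  bruhat_step u v -> exists a b, [/\ a < b, u a < u b & v = swap_pos u (a, b)].
Proof.
case/existsP => -[a b] /andP[/eqP-> len].
case: (ltngtP a b) => [ab|ba|/val_inj e].
- by exists a, b; split=> //; apply: swap_pos_ascent.
- have e : swap_pos u (a, b) = swap_pos u (b, a) by rewrite /swap_pos /= tpermC.
  by exists b, a; split=> //; apply: swap_pos_ascent; rewrite -?e.
- by move: len; rewrite e /swap_pos /= tperm1 mul1g ltnn.
Qed.

Lemma bruhat_le_trans : transitive (@bruhat_le n).
Proof. exact: connect_trans. Qed.

Lemma bruhat_le_first u v :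
  bruhat_le u v -> u != v -> exists2 y, bruhat_step u y & bruhat_le y v.
Proof.
case/connectP => -[|y p] /=; first by move=> _ ->; rewrite eqxx.
by case/andP=> uy py -> _; exists y => //; apply/connectP; exists p.
Qed.

Lemma bruhat_le_length u v : bruhat_le u v -> perm_length u <= perm_length v.
Proof.
case/connectP => p; elim: p u => [|y p ih] u /=; first by move=> _ ->.
case/andP=> /existsP[t /andP[_ len]] py ev.
by apply: (leq_trans (ltnW len)); apply: ih.
Qed.

Lemma bruhat_lt_length u v : bruhat_lt u v -> perm_length u < perm_length v.
Proof.
case/andP=> ne /bruhat_le_first /(_ ne)[y /existsP[t /andP[_ len]]].
by move/bruhat_le_length; apply: leq_trans.
Qed.

Lemma length_neq u v : perm_length u < perm_length v -> u != v.
Proof. by apply: contraTneq => ->; rewrite ltnn. Qed.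

(** The tableau criterion for the Bruhat order compares these numbers. *)
Definition corner_rank u (p q : nat) : nat :=
  \sum_(i < n) ((p <= i) && (q <= u i)).

(** The swap moves the two points of the graph from the lower left and upper right
    corners of their rectangle to the other two corners, so only the quadrants
    with corner in the rectangle lose a point. *)
Lemma corner_rank_swap u a b p q : a < b -> u a < u b ->
  corner_rank u p q =
  corner_rank (swap_pos u (a, b)) p q + [&& a < p, p <= b, u a < q & q <= u b].
Proof.
move=> ab uab; have ba : b != a by apply/eqP => e; move: ab; rewrite e ltnn.
rewrite /corner_rank (bigD1 a) //= (bigD1 b) //= [in RHS](bigD1 a) //=.
rewrite [in RHS](bigD1 b) //= !swap_posE /= tpermL tpermR.
rewrite (eq_bigr (fun i : 'I_n => ((p <= i) && (q <= u i) : nat))); last by [].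
rewrite [in RHS](eq_bigr (fun i : 'I_n => ((p <= i) && (q <= u i) : nat))).
  set S := \sum_(i < n | _) _; lia.
by move=> i /andP[ia ib]; rewrite swap_posE /= tpermD // eq_sym.
Qed.

Lemma corner_rank_le u v p q :
  bruhat_le u v -> corner_rank v p q <= corner_rank u p q.
Proof.
case/connectP => r; elim: r u => [|y r ih] u /=; first by move=> _ ->.
case/andP=> /bruhat_stepP[a [b [ab uab ey]]] ry ev.
by apply: (leq_trans (ih _ ry ev)); rewrite (corner_rank_swap _ _ ab uab) -ey leq_addr.
Qed.

(** A point inside the rectangle factors the swap into three length-increasing
    swaps.  Conversely, the quadrant counts confine the first step towards an
    element below [swap_pos u (a, b)] to a rectangle inside that of [(a, b)]; if
    the latter is empty, this first step is already [(a, b)]. *)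
Lemma bruhat_cover_swap u a b :
  a < b -> bruhat_cover u (swap_pos u (a, b)) = covers_at u (a, b).
Proof.
move=> ab; apply/idP/covers_atP => [/andP[lt_uv noz]|[_ uab gap]].
  have uab := swap_pos_ascent ab (bruhat_lt_length lt_uv).
  split=> // e ae eb; apply: contraT => /norP[nea nbe].
  have ea : e != a by apply/eqP => h; move: ae; rewrite h ltnn.
  have be : b != e by apply/eqP => h; move: eb; rewrite h ltnn.
  have uae : u a < u e by have := @perm_val_neq u _ _ ea; lia.
  have ueb : u e < u b by have := @perm_val_neq u _ _ be; lia.
  have ba : b != a by apply/eqP => h; move: ab; rewrite h ltnn.
  case/negP: noz; apply/existsP.
  pose y := swap_pos u (a, e); exists y.
  have len_y := perm_length_swap ae uae.
  have ya : y a = u e by rewrite swap_posE /= tpermL.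
  have ye : y e = u a by rewrite swap_posE /= tpermR.
  have yb : y b = u b by rewrite swap_posE /= tpermD // eq_sym.
  pose z := swap_pos y (a, b).
  have ze : z e = u a by rewrite swap_posE /= tpermD // eq_sym.
  have zb : z b = u e by rewrite swap_posE /= tpermR.
  have e_v : swap_pos u (a, b) = swap_pos z (e, b).
    rewrite /z swap_pos_conjr tpermR tpermD //; last by rewrite eq_sym.
    by rewrite /y /swap_pos /= (tpermC e a) (mulgA (tperm a e)) tperm2 mul1g.
  have len_z : perm_length y < perm_length z.
    by apply: perm_length_swap; rewrite ?ya ?yb.
  have len_v : perm_length z < perm_length (swap_pos u (a, b)).
    by rewrite e_v; apply: perm_length_swap; rewrite ?ze ?zb.
  rewrite /bruhat_lt !length_neq ?(ltn_trans len_z) //=.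
  rewrite bruhat_le_swap //= e_v; apply: (@bruhat_le_trans z).
    by apply: bruhat_le_swap; rewrite ?ya ?yb.
  by apply: bruhat_le_swap; rewrite ?ze ?zb.
have len := perm_length_swap ab uab.
rewrite /bruhat_cover {1}/bruhat_lt length_neq ?bruhat_le_swap //=.
apply/existsP => -[x /andP[/andP[ux le_ux] /andP[xv le_xv]]].
have [y /bruhat_stepP[c [d [cd ucd ey]]] le_yx] := bruhat_le_first le_ux ux.
(* The rectangle of the first step towards [x] lies inside that of [(a, b)]. *)
have inside p q : [&& c < p, p <= d, u c < q & q <= u d] ->
    [&& a < p, p <= b, u a < q & q <= u b].
  move=> in_cd; have := corner_rank_le p q (bruhat_le_trans le_yx le_xv).
  have := corner_rank_swap p q cd ucd; have := corner_rank_swap p q ab uab.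
  by rewrite -ey in_cd; case: [&& _, _, _ & _] => //; lia.
have := inside c.+1 (u c).+1; have := inside d (u d : nat).
move=> h1 h2.
have ca : c = a.
  apply/val_inj; have := @perm_val_neq u a c.
  case: (eqVneq a c) => [->|ne] // /(_ isT).
  by have := gap c; move: ne; rewrite -(inj_eq val_inj) /=; lia.
have db : d = b.
  apply/val_inj; have := @perm_val_neq u d b.
  case: (eqVneq d b) => [->|ne] // /(_ isT).
  by have := gap d; move: ne; rewrite -(inj_eq val_inj) /=; lia.
have := bruhat_le_length le_yx; rewrite ey ca db leqNgt => /negP; apply.
by apply: bruhat_lt_length; rewrite /bruhat_lt xv.
Qed.

Lemma bruhat_coverP u v :
  bruhat_cover u v -> exists2 t, covers_at u t & v = swap_pos u t.
Proof.
move=> cov; have /andP[/andP[ne le_uv] noz] := cov.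
have [y uy yv] := bruhat_le_first le_uv ne.
have e : y = v.
  apply/eqP; apply: contraNT noz => yv_ne; apply/existsP; exists y.
  have le_uy : bruhat_le u y := connect1 uy.
  rewrite /bruhat_lt yv_ne yv le_uy !andbT length_neq //.
  by case/existsP: uy => t /andP[].
have [a [b [ab _ ev]]] := bruhat_stepP uy; exists (a, b); last by rewrite -e.
by rewrite -bruhat_cover_swap // -ev e.
Qed.

Lemma covers_at_cover u t : covers_at u t -> bruhat_cover u (swap_pos u t).
Proof. by case: t => a b h; rewrite bruhat_cover_swap //; case/covers_atP: h. Qed.

Lemma covers_at_length u t :
  covers_at u t -> perm_length u < perm_length (swap_pos u t).
Proof. by case: t => a b /covers_atP[ab uab _]; apply: perm_length_swap. Qed.

Definition atom u x t := covers_at u t && bruhat_le (swap_pos u t) x.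

Lemma atom_exists u x : bruhat_le u x -> u != x -> exists t, atom u x t.
Proof.
move=> le_ux ne.
pose P z := bruhat_lt u z && bruhat_le z x.
have Px : P x by rewrite /P /bruhat_lt ne le_ux; apply: connect0.
case: (arg_minnP (@perm_length n) Px) => z /andP[uz zx] zmin.
have cov : bruhat_cover u z.
  rewrite /bruhat_cover uz; apply/existsP => -[y /andP[uy yz]].
  have := bruhat_lt_length yz; rewrite ltnNge zmin //.
  by rewrite /P uy; apply: bruhat_le_trans zx; case/andP: yz.
by have [t ct ez] := bruhat_coverP cov; exists t; rewrite /atom ct -ez.
Qed.

(** * Crossing labels and k-covers *)

Variable k : nat.

Definition crossing t := t.1 < k <= t.2.

Lemma first_values_crossing u t :
  covers_at u t -> (first_values k u != first_values k (swap_pos u t)) = crossing t.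
Proof.
case: t => a b /covers_atP[ab _ _]; rewrite /crossing /=.
apply/idP/idP => [|/andP[ak kb]].
  apply: contraNT => nc; apply/eqP; rewrite /first_values.
  apply/setP => y; apply/imsetP/imsetP => -[i]; rewrite inE => ik ->.
    exists (tperm a b i); last by rewrite swap_posE tpermK.
    by rewrite inE; case: tpermP ik nc => [->|->|] //; lia.
  exists (tperm a b i); last by rewrite swap_posE.
  by rewrite inE; case: tpermP ik nc => [->|->|] //; lia.
apply/eqP => /setP/(_ (u a)); rewrite imset_f ?inE //.
move/esym/imsetP => [i]; rewrite inE swap_posE /= => ik.
move/perm_inj => e; have ib : i = b by rewrite -(tpermK a b i) -e tpermL.
by move: ik; rewrite ib; lia.
Qed.

Lemma kcover_swap u t : t.1 < t.2 ->
  kcover k u (swap_pos u t) = covers_at u t && crossing t.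
Proof.
case: t => a b ab; rewrite /kcover bruhat_cover_swap //.
by case: (boolP (covers_at u _)) => //= /first_values_crossing.
Qed.

(** The first step of a chain of [k]-covers from [u] to a cover [v] of [u] has to
    reach [v]. *)
Lemma kcover_kbruhat_lt u v : bruhat_cover u v -> kbruhat_lt k u v = kcover k u v.
Proof.
move=> cov; apply/idP/idP => [|kc]; last first.
  rewrite /kbruhat_lt /kbruhat_le connect1 // andbT.
  by case/andP: cov => /andP[].
case/andP=> ne /connectP[[|z p] /=]; first by move=> _ e; rewrite e eqxx in ne.
case/andP=> uz pz ev; suff -> : v = z by [].
apply/eqP; case/andP: cov => _; apply: contraNT => nz.
apply/existsP; exists z; case/andP: uz => /andP[-> _] _ /=.
rewrite /bruhat_lt eq_sym nz /=.
have: connect (kcover k) z v by apply/connectP; exists p.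
apply: connect_sub => y y' /andP[/andP[/andP[_ h] _] _]; exact: h.
Qed.

(** * From crossing atoms to an increasing chain *)

Local Ltac nat_lia :=
  repeat match goal with H : is_true (~~ (_ == _)) |- _ => clear H end; lia.

(* The points over [a] and [b] move in the first swap and are treated apart; the
   other points avoid the rectangles of both swaps, by [gapt] and [gape]. *)
Local Ltac empty_rectangle num gapt gape a b :=
  let e := fresh "e" in let ea := fresh "ea" in let eb := fresh "eb" in
  apply/covers_atP; split; [nat_lia | nat_lia | intros e ? ?];
  destruct (eqVneq e a) as [?|ea]; [subst e; nat_lia|];
  destruct (eqVneq e b) as [?|eb]; [subst e; nat_lia|];
  generalize (num _ _ ea) (num _ _ eb) (gapt e) (gape e ea eb); nat_lia.

(** The rank-two case of shellability.  With [t] and [s] read as transpositions,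
    [t s = s (s t s) = (t s t) t], so [s] and [t s t] are the two candidates for
    another atom of the interval.  In each relative position of [t] and [s], one
    of them is an atom that comes before [t]: its rectangle is empty because it is
    covered by the empty rectangles of the two given swaps. *)
Lemma atom_exchange u t s :
  crossing t -> covers_at u t -> covers_at (swap_pos u t) s ->
  ~~ (crossing s && label_order t s) ->
  exists2 t', atom u (swap_pos (swap_pos u t) s) t'
            & ~~ crossing t' || label_order t' t.
Proof.
case: t s => a b [c d] /andP[/= ak kb].
move=> /covers_atP[ab uab gapt] /covers_atP[cd vcd gaps].
rewrite /crossing /label_order /= => early.
(* The other chain is [s], [s t s] in [conjl], and [t s t], [t] in [conjr]. *)
have conjl : covers_at u (c, d) -> tperm c d a < tperm c d b ->
    atom u (swap_pos (swap_pos u (a, b)) (c, d)) (c, d).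
  move=> cov h; rewrite /atom cov swap_pos_conjl; apply: bruhat_le_swap => //.
  by rewrite !swap_posE /= !tpermK.
have conjr r : r = (tperm a b c, tperm a b d) -> covers_at u r ->
    swap_pos u r a < swap_pos u r b ->
    atom u (swap_pos (swap_pos u (a, b)) (c, d)) r.
  by move=> er cov h; rewrite /atom cov swap_pos_conjr -er; apply: bruhat_le_swap.
have vE e : e != a -> e != b -> swap_pos u (a, b) e = u e.
  by move=> ea eb; rewrite swap_posE /= tpermD // eq_sym.
have va : swap_pos u (a, b) a = u b by rewrite swap_posE /= tpermL.
have vb : swap_pos u (a, b) b = u a by rewrite swap_posE /= tpermR.
have not_after : [|| d < k, k <= c, b < d | ~~ (d < b) && (c <= a)].
  by move: early; rewrite -(inj_eq val_inj) /=; lia.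
have gapa : c < a -> a < d ->
    (u b < swap_pos u (a, b) c) || (swap_pos u (a, b) d < u b).
  by rewrite -va; apply: gaps.
have gapb : c < b -> b < d ->
    (u a < swap_pos u (a, b) c) || (swap_pos u (a, b) d < u a).
  by rewrite -vb; apply: gaps.
have gape e : e != a -> e != b -> c < e -> e < d ->
    (u e < swap_pos u (a, b) c) || (swap_pos u (a, b) d < u e).
  by move=> ea eb; rewrite -(vE e) //; apply: gaps.
move=> {gaps early}.
have inj (i j : 'I_n) : (i : nat) <> j -> (u i : nat) <> u j.
  by move=> ne; apply: perm_val_neq; apply: contra_not_neq ne => ->.
have ltn_neq (i j : 'I_n) : (i < j) || (j < i) -> (i != j) && (j != i).
  by rewrite -!(inj_eq val_inj) /=; lia.
have num (i j : 'I_n) : i != j -> (i : nat) <> j.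
  by move/eqP=> ne /val_inj.
have /andP[neab neba] : (a != b) && (b != a) by apply: ltn_neq; rewrite ab.
have /andP[necd nedc] : (c != d) && (d != c) by apply: ltn_neq; rewrite cd.
(* Two swaps that share a position permute three positions cyclically, and the
   choice depends on which of them are below [k] and on the pattern of [u]. *)
case: (eqVneq c a) => [eca|ca].
  subst c; have db : d != b by apply/eqP => e; move: vcd; rewrite e va vb; lia.
  have db' := num _ _ db.
  have bd : b != d by rewrite eq_sym.
  move: vcd gapa gapb gape; rewrite va vE // => vcd gapa gapb gape.
  case: (ltnP d k) => [dk|kd].
    exists (a, d); last by rewrite /crossing /=; nat_lia.
    apply: conjl; last by rewrite tpermL tpermD //; nat_lia.
    empty_rectangle num gapt gape a b.
  exists (b, d); last by rewrite /crossing /=; nat_lia.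
  apply: conjr; first by rewrite tpermL tpermD.
    empty_rectangle num gapt gape a b.
  by rewrite !swap_posE /= tpermL tpermD //; nat_lia.
have ca' := num _ _ ca.
case: (eqVneq d b) => [edb|db].
  subst d; have ac : a != c by rewrite eq_sym.
  move: vcd gapa gapb gape; rewrite vb vE // => vcd gapa gapb gape.
  case: (ltnP c k) => [ck|kc].
    exists (c, a); last by rewrite /crossing /=; nat_lia.
    apply: conjr; first by rewrite tpermR tpermD.
      empty_rectangle num gapt gape a b.
    by rewrite !swap_posE /= tpermR tpermD //; nat_lia.
  exists (c, b); last by rewrite /crossing /=; nat_lia.
  apply: conjl; last by rewrite tpermR tpermD //; nat_lia.
  empty_rectangle num gapt gape a b.
have db' := num _ _ db.
case: (eqVneq d a) => [eda|da].
  subst d; have bc : b != c by apply/eqP => e; move: cd; rewrite -e; nat_lia.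
  have cb : c != b by rewrite eq_sym.
  have ac : a != c by rewrite eq_sym.
  move: vcd gapa gapb gape; rewrite va vE // => vcd gapa gapb gape.
  case: (ltnP (u c) (u a)) => [uca|uac].
    exists (c, a); last by rewrite /crossing /=; nat_lia.
    apply: conjl; last by rewrite tpermR tpermD //; nat_lia.
    empty_rectangle num gapt gape a b.
  have {}uac : u a < u c by have := inj a c; nat_lia.
  exists (c, b); last by rewrite /crossing /label_order /= eqxx; nat_lia.
  apply: conjr; first by rewrite tpermL tpermD.
    empty_rectangle num gapt gape a b.
  by rewrite !swap_posE /= tpermR tpermD //; nat_lia.
case: (eqVneq c b) => [ecb|cb].
  subst c; have ad : a != d by rewrite eq_sym.
  have bd : b != d by rewrite eq_sym.
  move: vcd gapa gapb gape; rewrite vb vE // => vcd gapa gapb gape.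
  case: (ltnP (u b) (u d)) => [ubd|udb].
    exists (b, d); last by rewrite /crossing /=; nat_lia.
    apply: conjl; last by rewrite tpermL tpermD //; nat_lia.
    empty_rectangle num gapt gape a b.
  have {}udb : u d < u b by have := inj b d; nat_lia.
  exists (a, d); last by rewrite /crossing /label_order /=; nat_lia.
  apply: conjr; first by rewrite tpermR tpermD.
    empty_rectangle num gapt gape a b.
  by rewrite !swap_posE /= tpermL tpermD //; nat_lia.
(* The swaps now move disjoint pairs of positions, and commute. *)
move: vcd gapa gapb gape; rewrite !vE // => vcd gapa gapb gape.
exists (c, d).
  apply: conjl; last by rewrite !tpermD // eq_sym.
  have gapc := gapt c; have gapd := gapt d.
  empty_rectangle num gapt gape a b.
move: not_after; rewrite /crossing /label_order /=.
rewrite -!(inj_eq val_inj) /=; nat_lia.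
Qed.

(** A numeric encoding of [label_order], used to pick a smallest atom. *)
Definition label_key t : nat := (n - t.2) * n + t.1.

Lemma label_order_key t t' : label_order t t' -> label_key t < label_key t'.
Proof.
case: t t' => a b [a' b']; rewrite /label_order /label_key /=.
case/orP=> [lt|/andP[/eqP-> lt]]; last by rewrite ltn_add2l.
have h : (n - b).+1 * n <= (n - b') * n by rewrite leq_mul2r; have := ltn_ord b; lia.
by have := ltn_ord a; rewrite mulSn in h; lia.
Qed.

Lemma label_order_trans : transitive (@label_order n).
Proof.
move=> [c d] [a b] [e f]; rewrite /label_order -!(inj_eq val_inj) /=; lia.
Qed.

(** The chain starts with the smallest atom; the last clause lets the induction
    compare this label with the head of the chain of the remaining interval. *)
Lemma increasing_chain u x :
  bruhat_le u x -> (forall t, atom u x t -> crossing t) ->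
  exists ts, [/\ all crossing ts, path (kcover k) u (chain_of u ts),
    last u (chain_of u ts) = x, sorted (@label_order n) ts
    & if ts is t :: _ then atom u x t else true].
Proof.
have [m] := ubnP (perm_length x - perm_length u).
elim: m u => // m ih u len le_ux cross.
case: (eqVneq u x) => [<-|ne]; first by exists [::].
have [t0 at0] := atom_exists le_ux ne.
case: (arg_minnP label_key at0) => t att tmin.
have /andP[cov le_vx] := att; set v := swap_pos u t in le_vx.
have next s : atom v x s -> crossing s && label_order t s.
  move=> /andP[covs le_sx]; apply: contraT => early.
  have [t' /andP[covt' le_t'] h] := atom_exchange (cross t att) cov covs early.
  have att' : atom u x t' by rewrite /atom covt' (bruhat_le_trans le_t').
  move: h; rewrite (cross t' att') /= => /label_order_key.
  by rewrite ltnNge tmin.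
have [|s /next/andP[]//|ts [cts pts lts sts hts]] := ih v _ le_vx.
  by have := covers_at_length cov; have := bruhat_le_length le_vx; rewrite -/v; lia.
exists (t :: ts); split=> //=; first by rewrite cts (cross t att).
  rewrite -/v pts andbT kcover_swap ?cov ?(cross t att) //.
  by have /and3P[] := cov.
by case: ts hts sts {cts pts lts} => //= s ts /next/andP[_ ->] ->.
Qed.

(** * From an increasing chain to crossing atoms *)

Lemma chain_cons u t ts : all crossing (t :: ts) ->
    path (kcover k) u (chain_of u (t :: ts)) -> sorted (@label_order n) (t :: ts) ->
  [/\ crossing t, covers_at u t & forall t', t' \in ts -> label_order t t']
  /\ [/\ all crossing ts, path (kcover k) (swap_pos u t) (chain_of (swap_pos u t) ts)
      & sorted (@label_order n) ts].
Proof.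
move=> /= /andP[ct cts] /andP[kc pts] sts; split; split=> //.
- move: kc; rewrite kcover_swap; first by case/andP.
  by case/andP: ct; apply: leq_trans.
- by move=> t' t'ts; apply: (allP (order_path_min label_order_trans sts)).
- exact: path_sorted sts.
Qed.

(** For an atom [(a, b)] with [k <= a], the quadrant is that of the points over
    positions [>= b] with values above [u a].  A swap [(a1, b1)] matters only if
    [b <= b1].  As the second positions never increase along the chain, position [a] has
    not been touched by then (the hypothesis on [y], which is kept by the
    induction).  Since [a1 < a < b1], the point over [a], at height [y], would lie
    inside the rectangle of the swap if the latter exchanged a value below [y] with
    one above [y]. *)
Lemma corner_rank_right_atom u ts a b (y : nat) :
    k <= a -> a < b -> all crossing ts -> path (kcover k) u (chain_of u ts) ->
    sorted (@label_order n) ts ->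
    (forall t, t \in ts -> b <= t.2 -> u a = y :> nat) ->
  corner_rank (last u (chain_of u ts)) b y.+1 = corner_rank u b y.+1.
Proof.
move=> ka ab; elim: ts u => [//|[a1 b1] ts ih] u cts pts sts inv.
have [[/andP[/= a1k kb1] cov after] [cts' pts' sts']] := chain_cons cts pts sts.
have [a1b1 ua1b1 gap] := covers_atP _ _ _ cov.
have ne1 : a1 != a by apply/eqP => e; move: a1k; rewrite e; lia.
rewrite /= ih //; last first.
  move=> [a' b'] in' /= bb'.
  have bb1 : b <= b1.
    by have := after _ in'; rewrite /label_order -(inj_eq val_inj) /=; lia.
  have ne2 : b1 != a by apply/eqP => e; move: bb1; rewrite e; lia.
  rewrite swap_posE /= tpermD //; apply: inv (mem_head _ _) _; exact: bb1.
rewrite [RHS](corner_rank_swap _ _ a1b1 ua1b1).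
have [bb1|] := leqP b b1; last by move=> *; lia.
have uay := inv _ (mem_head _ _) bb1.
have := gap a; have := @perm_val_neq u a1 a ne1; lia.
Qed.

(** For an atom [(a, c)] with [c < k], the quadrant is that of the points over
    positions [>= c] with values [>= y], where [y] is the initial value at [c].
    The value at [c] only grows, and the invariant is that no position that is
    still to be swapped with one on the left of [c] has a value in [[y, u c]].  A
    swap across [c] that changed the count would have to start below [y] and end
    above [u c], with the point over [c] inside its rectangle. *)
Lemma corner_rank_left_atom u ts c (y : nat) :
    c < k -> all crossing ts -> path (kcover k) u (chain_of u ts) ->
    sorted (@label_order n) ts -> y <= u c ->
    (forall t, t \in ts -> t.1 < c -> (u t.2 < y) || (u c < u t.2)) ->
  corner_rank (last u (chain_of u ts)) c y = corner_rank u c y.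
Proof.
move=> ck; elim: ts u => [//|[a1 b1] ts ih] u cts pts sts yc inv.
have [[/andP[/= a1k kb1] cov after] [cts' pts' sts']] := chain_cons cts pts sts.
have [a1b1 ua1b1 gap] := covers_atP _ _ _ cov.
have b1c : b1 != c by apply/eqP => e; move: kb1; rewrite e; lia.
have := inv _ (mem_head _ _); rewrite /= => inv1.
rewrite /= ih //.
- rewrite [RHS](corner_rank_swap _ _ a1b1 ua1b1).
  by have := gap c; lia.
- rewrite swap_posE /=; case: (eqVneq a1 c) => [e|ne]; last by rewrite tpermD.
  by rewrite e tpermL; move: ua1b1; rewrite e; lia.
move=> [a' b'] in' /= a'c.
have /andP[/= _ kb'] := allP cts' _ in'.
have /= ord := after _ in'.
have /= inv' := inv (a', b') (mem_behead (s := _ :: _) in') a'c.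
have a1b' : a1 != b' by apply: contraTneq kb' => <-; rewrite -ltnNge.
rewrite !swap_posE /=; case: (eqVneq b' b1) => [eb|b'b1].
  (* The labels increase, so both swaps start on the left of [c]: the value at
     [b1] goes down, and cannot jump over that at [c]. *)
  have a1a' : a1 < a' by move: ord; rewrite /label_order /= eb ltnn eqxx.
  have a1c : a1 != c by apply: contraTneq a1a' => ->; rewrite -leqNgt ltnW.
  rewrite eb tpermR tpermD //.
  by have := gap c; have := @perm_val_neq u _ _ a1c; clear ord inv'; nat_lia.
have lt : b' < b1 by move: ord; rewrite /label_order /= eq_sym (negPf b'b1) orbF.
have -> : tperm a1 b1 b' = b' by rewrite tpermD // eq_sym.
(* If the value at [c] grows to [u b1], then the emptiness of the rectangle keeps
   the values at the positions before [b1] out of the enlarged range. *)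
case: (eqVneq a1 c) => [e|a1c]; last by rewrite tpermD.
by rewrite e tpermL; have := gap b'; rewrite e; clear ord; nat_lia.
Qed.

Lemma chain_atom_crossing u ts t :
    all crossing ts -> path (kcover k) u (chain_of u ts) ->
    sorted (@label_order n) ts -> atom u (last u (chain_of u ts)) t ->
  crossing t.
Proof.
case: t => a b cts pts sts /andP[cov le_x]; have [ab uab gap] := covers_atP _ _ _ cov.
apply: contraT; rewrite /crossing /= => nc.
have no_corner q : u a < q <= u b ->
    corner_rank (last u (chain_of u ts)) b q = corner_rank u b q -> False.
  move=> qab e; have := corner_rank_le b q le_x.
  by rewrite e (corner_rank_swap _ _ ab uab); lia.
have [ka|ak] := leqP k a.
  exfalso; apply: (no_corner (u a).+1); first by rewrite ltnSn.
  exact: (corner_rank_right_atom (y := u a) ka ab cts pts sts).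
have bk : b < k by move: nc; rewrite ak; lia.
exfalso; apply: (no_corner (u b)); first by rewrite uab leqnn.
apply: corner_rank_left_atom => // t tts _.
have /andP[_ kt] := allP cts _ tts.
have ne : t.2 != b by apply/eqP => e; move: kt; rewrite e; lia.
by have := @perm_val_neq u _ _ ne; lia.
Qed.

End Bruhat.

(** * The two sets coincide *)

Theorem proposition7p16 (n k : nat) (hk : 1 <= k) (hkn : k < n) (u w : 'S_n)
    (huw : bruhat_le u w) (hw : grassmannian k w) :
  forall x : 'S_n, Lk' k u w x <-> Lk k u w x.
Proof.
move=> x; split=> -[xw hx]; split=> //; have /andP[/andP[_ le_ux] _] := xw.
  have [t /andP[cov le_tx]|ts [cts pts lts sts _]] := @increasing_chain n k u x le_ux.
    rewrite -(first_values_crossing k cov); have covB := covers_at_cover cov.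
    by have := hx _ covB le_tx; rewrite kcover_kbruhat_lt // => /andP[].
  by exists ts; split.
case: hx => ts [cts pts lts sts] v covB le_vx.
have [t cov ev] := bruhat_coverP covB.
rewrite kcover_kbruhat_lt // /kcover covB ev (first_values_crossing k cov) /=.
by apply: (chain_atom_crossing cts pts sts); rewrite lts /atom cov -ev.
Qed.
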